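(* Let $A$ and $B$ be sets. The canonical isomorphism of abstract convex spaces $\varphi\colon\mathcal D(A+B)\to\mathcal DA\star\mathcal DB$ is given, for $\omega\in\mathcal D(A+B)$ with restrictions $\omega_1$ to $A$ and $\omega_2$ to $B$, by $$\varphi(\omega)=\begin{cases}\iota_1(\omega_1)&\text{if }\omega_1(A)=1;\\ \iota_2(\omega_2)&\text{if }\omega_2(B)=1;\\ \omega_1(A)\cdot\overline{\omega_1}+\omega_2(B)\cdot\overline{\omega_2}&\text{otherwise.}\end{cases}$$
   Context: A finitely supported sub-probability distribution on a set $A$ is a function $\omega\colon A\to[0,1]$ with finite support and $\omega(A):=\sum_{a\in A}\omega(a)\le1$; it is a probability distribution if $\omega(A)=1$. $\mathcal DA$ is the set of finitely supported probability distributions on $A$. If $\omega(A)>0$, its normalisation is $\overline\omega\in\mathcal DA$, $\overline\omega(a)=\omega(a)/\omega(A)$. For $r\in[0,1]$ write $r^*=1-r$. An abstract convex space is a set $A$ with an operation $(0,1)\times A\times A\to A$, $(r,a,b)\mapsto r(a,b)$, such that $r(a,a)=a$, $r(a,b)=r^*(b,a)$, and $r(s(a,b),c)=(rs)\bigl(a,\tfrac{r s^*}{(rs)^*}(b,c)\bigr)$; one also sets $1(a,b)=a$, $0(a,b)=b$. Convex maps are functions preserving these operations. $\mathcal DA$ is an abstract convex space under pointwise convex combination $r(\omega,\omega')=r\omega+r^*\omega'$, and is the free abstract convex space on the set $A$ via $\eta_A\colon A\to\mathcal DA$ sending $a$ to the point distribution at $a$. The coproduct of abstract convex spaces $A,B$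 is $A\star B=A+\bigl((0,1)\times A\times B\bigr)+B$, whose elements in the three summands are written $\iota_1(a)$, $r\cdot a+r^*\cdot b$ (for the triple $(r,a,b)$), and $\iota_2(b)$, the coprojections being $\iota_1,\iota_2$. Its convex structure is the one in which elements are treated as formal convex combinations: writing $\iota_1(a)$ as $1\cdot a+0\cdot b$ and $\iota_2(b)$ as $0\cdot a+1\cdot b$ (with the weight-$0$ component absent), the combination $r\bigl(s\cdot a+s^*\cdot b,\;t\cdot a'+t^*\cdot b'\bigr)$ is $p\cdot\bigl(\tfrac{rs}{p}\bigr)_A(a,a')+p^*\cdot\bigl(\tfrac{rs^*}{p^*}\bigr)_B(b,b')$ with $p=rs+r^*t$. The map $\varphi\colon\mathcal D(A+B)\to\mathcal DA\star\mathcal DB$ is the canonical comparison between coproducts, i.e. the unique convex map whose restriction along $\eta_{A+B}$ is the function $A+B\xrightarrow{\eta_A+\eta_B}\mathcal DA+\mathcal DB\hookrightarrow\mathcal DA\star\mathcal DB$; it is an isomorphism since the free functor preserves coproducts. *)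

(* Defs.v *)
From HB Require Import structures.
From mathcomp Require Import all_boot all_order all_algebra.
From mathcomp Require Import interval_inference.
From mathcomp Require Import unstable mathcomp_extra boolp classical_sets functions.
From mathcomp Require Import cardinality fsbigop set_interval reals convex.
From mathcomp Require Import ring.

Set Implicit Arguments.
Unset Strict Implicit.
Unset Printing Implicit Defensive.

Import Order.TTheory GRing.Theory Num.Theory.

Local Open Scope classical_set_scope.
Local Open Scope ring_scope.
Local Open Scope convex_scope.

Section Mass.
Context {R : realType} {A : Type}.
Implicit Types f g : A -> R.

(* [{classic A}] is [A] with a choice structure, which [\sum_(_ \in _)] needs. *)
Definition mass f : R := \sum_(a \in [set: {classic A}]) f a.

Definition supp f : set A := [set a | f a != 0].

Lemma mass_widen f (X : set A) :
  supp f `<=` X -> mass f = \sum_(a \in (X : set {classic A})) f a.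
Proof.
move=> fX; apply/esym/fsbig_widen => // a [_ Xa] /=.
by apply/eqP/negPn/negP => fa; apply: Xa; apply: fX.
Qed.

Lemma massZ k f : mass (fun a => k * f a) = k * mass f.
Proof. by rewrite /mass mulr_fsumr. Qed.

Lemma massD f g : finite_set (supp f) -> finite_set (supp g) ->
  mass (fun a => f a + g a) = mass f + mass g.
Proof.
move=> ff fg; pose X := supp f `|` supp g.
have Xfin : finite_set X by rewrite finite_setU.
rewrite (@mass_widen f X) ?(@mass_widen g X).
- rewrite -fsbig_split//; apply: mass_widen => a /=.
  rewrite /supp /X /= => fga; have [fa|fa] := eqVneq (f a) 0; last by left.
  by right; move: fga; rewrite fa add0r.
- by move=> a; right.
- by move=> a; left.
Qed.

Lemma mass_le f g : finite_set (supp f) -> finite_set (supp g) ->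
  (forall a, f a <= g a) -> mass f <= mass g.
Proof.
move=> ff fg fg_le; rewrite -subr_ge0 -[- mass f]mulN1r -massZ -massD//.
  by apply: fsumr_ge0 => a _; rewrite mulN1r subr_ge0.
by apply: sub_finite_set ff => a; rewrite /supp /= mulN1r oppr_eq0.
Qed.

Lemma mass_point a : mass (fun x => `[< x = a >]%:R) = 1.
Proof.
rewrite (@mass_widen _ [set a]).
  by rewrite fsbig_set1; case: asboolP.
by move=> x /=; rewrite /supp /=; case: asboolP => // _; rewrite eqxx.
Qed.

Lemma le_mass f a : finite_set (supp f) -> (forall x, 0 <= f x) ->
  f a <= mass f.
Proof.
move=> ff f0; rewrite -[leLHS]mulr1 -(mass_point a) -massZ; apply: mass_le => //.
  apply: (@sub_finite_set _ _ [set a]) => // x; rewrite /supp /=.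
  by case: asboolP => // _; rewrite mulr0 eqxx.
by move=> x; case: asboolP => [->|_]; rewrite ?mulr1 ?mulr0.
Qed.

End Mass.

Section Distributions.
Context {R : realType}.

Record subdist (A : Type) := SubDist {
  subdist_fun :> A -> R ;
  subdist_itv : forall a, 0 <= subdist_fun a <= 1 ;
  subdist_fin : finite_set (supp subdist_fun) ;
  subdist_mass : mass subdist_fun <= 1 }.

Record dist (A : Type) := Dist {
  dist_sub :> subdist A ;
  dist_mass : mass dist_sub = 1 }.

Lemma subdist_ext A (v w : subdist A) : (forall a, v a = w a) -> v = w.
Proof.
case: v w => [v v1 v2 v3] [w w1 w2 w3] /= /funext vw; subst w.
by congr SubDist; exact: Prop_irrelevance.
Qed.

Lemma dist_ext A (v w : dist A) : (forall a, v a = w a) -> v = w.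
Proof.
case: v w => [v v1] [w w1] /= /subdist_ext vw; subst w.
by congr Dist; exact: Prop_irrelevance.
Qed.

Section Normalise.
Context A (w : subdist A) (w0 : 0 < mass w).

Let f a := w a / mass w.

Let f_fin : finite_set (supp f).
Proof.
apply: sub_finite_set (subdist_fin w) => a; rewrite /supp /= mulf_eq0.
by rewrite negb_or => /andP[].
Qed.

Let f_itv a : 0 <= f a <= 1.
Proof.
have /andP[wa _] := subdist_itv w a.
rewrite divr_ge0 ?(ltW w0)//= ler_pdivrMr// mul1r le_mass//.
  exact: subdist_fin.
by move=> x; have /andP[] := subdist_itv w x.
Qed.

Let f_mass : mass f = 1.
Proof.
rewrite (_ : f = fun a => (mass w)^-1 * w a); last first.
  by apply/funext => a; rewrite mulrC.
by rewrite massZ mulVf ?gt_eqF.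
Qed.

Let f_mass_le : mass f <= 1. Proof. by rewrite f_mass. Qed.

Definition normalise : dist A := @Dist A (SubDist f_itv f_fin f_mass_le) f_mass.

End Normalise.

Section Point.
Context A (x : A).

Let f a : R := `[< a = x >]%:R.

Let f_itv a : 0 <= f a <= 1.
Proof. by rewrite /f; case: asboolP; rewrite ?lexx ler01. Qed.

Let f_fin : finite_set (supp f).
Proof.
apply: (@sub_finite_set _ _ [set x]) => // a; rewrite /supp /f /=.
by case: asboolP => // _; rewrite eqxx.
Qed.

Let f_mass_le : mass f <= 1. Proof. by rewrite mass_point. Qed.

Definition point : dist A :=
  @Dist A (SubDist f_itv f_fin f_mass_le) (mass_point x).

End Point.

Section Restriction.
Context A C (i : A -> C) (i_inj : injective i) (w : subdist C).

Let f a := w (i a).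

Let f_fin : finite_set (supp f).
Proof.
have : finite_set (i @^-1` supp w) => //; apply: finite_preimage.
  by move=> a a' _ _; apply: i_inj.
exact: subdist_fin.
Qed.

Let f_mass_le : mass f <= 1.
Proof.
apply: le_trans (subdist_mass w).
pose X : set C := range i.
rewrite /mass -(fsbig_image _ (i : {classic A} -> {classic C}) w); last first.
  by move=> a a' _ _; apply: i_inj.
have -> : \sum_(c \in (i : {classic A} -> {classic C}) @` [set: {classic A}]) w c
    = mass (fun c => w c * `[< X c >]%:R).
  rewrite (@mass_widen _ _ _ X); last first.
    move=> c; rewrite /supp /=; case: asboolP => // _.
    by rewrite mulr0 eqxx.
  apply: eq_fsbigr => c; rewrite inE => Xc.
  by case: asboolP => [_|//]; rewrite mulr1.
apply: mass_le.
- apply: sub_finite_set (subdist_fin w) => c; rewrite /supp /= mulf_eq0.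
  by rewrite negb_or => /andP[].
- exact: subdist_fin.
- move=> c; have /andP[wc _] := subdist_itv w c.
  by case: asboolP => _; rewrite ?mulr1 ?mulr0.
Qed.

Definition restr : subdist A :=
  SubDist (fun a => subdist_itv w (i a)) f_fin f_mass_le.

End Restriction.

Section Mixture.
Context (A : Type).
Implicit Types v w u : dist A.

Section Mix.
Context (r : {i01 R}) (v w : dist A).

Let f a : R := r%:num * v a + r%:num.~ * w a.

Let f_itv a : 0 <= f a <= 1.
Proof.
have /andP[v0 v1] := subdist_itv v a; have /andP[w0 w1] := subdist_itv w a.
rewrite /f addr_ge0 ?mulr_ge0 ?onem_ge0//=.
rewrite -[X in _ <= X](add_onemK r%:num).
by apply: lerD; rewrite -[leRHS]mulr1 ler_wpM2l ?onem_ge0.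
Qed.

Let Zfin k (h : dist A) : finite_set (supp (fun a => k * h a)).
Proof.
apply: sub_finite_set (subdist_fin h) => a; rewrite /supp /= mulf_eq0.
by rewrite negb_or => /andP[].
Qed.

Let f_fin : finite_set (supp f).
Proof.
apply: (@sub_finite_set _ _ (supp v `|` supp w)); last first.
  by rewrite finite_setU; split; apply: subdist_fin.
move=> a; rewrite /supp /f /=; have [->|_ _] := eqVneq (v a) 0; last by left.
rewrite mulr0 add0r mulf_eq0 negb_or => /andP[_ wa]; by right.
Qed.

Let f_mass : mass f = 1.
Proof. by rewrite massD// !massZ !dist_mass !mulr1 add_onemK. Qed.

Let f_mass_le : mass f <= 1. Proof. by rewrite f_mass. Qed.

Definition dist_conv : dist A := @Dist A (SubDist f_itv f_fin f_mass_le) f_mass.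

End Mix.

Lemma dist_convE r v w a :
  dist_conv r v w a = r%:num * v a + r%:num.~ * w a.
Proof. by []. Qed.

Let conv1 v w : dist_conv 1%:i01 v w = v.
Proof. by apply: dist_ext => a; rewrite dist_convE onem1 mul1r mul0r addr0. Qed.

Let convmm r v : dist_conv r v v = v.
Proof. by apply: dist_ext => a; rewrite dist_convE -mulrDl add_onemK mul1r. Qed.

Let convC r v w : dist_conv r v w = dist_conv (1 - r%:inum)%:i01 w v.
Proof. by apply: dist_ext => a; rewrite !dist_convE /= -!/(onem _) onemK addrC. Qed.

Let convA : convex_quasi_associative dist_conv.
Proof.
move=> p q r s u v w prs spq; apply: dist_ext => a; rewrite !dist_convE.
rewrite !mulrDr addrA !mulrA; congr (_ * _ + _ * _ + _ * _) => //.
- by rewrite mulrC.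
- exact: ConvexQuasiAssoc.pq_sr prs spq.
Qed.

HB.instance Definition _ := gen_eqMixin (dist A).
HB.instance Definition _ := gen_choiceMixin (dist A).
HB.instance Definition _ :=
  isConvexSpace.Build R (dist A) conv1 convmm convC convA.

End Mixture.
End Distributions.

Arguments subdist : clear implicits.
Arguments dist : clear implicits.

Definition convex_map (R : realType) (A B : convType R) (f : A -> B) : Prop :=
  forall (r : {i01 R}) (a a' : A), f (a <| r |> a') = f a <| r |> f a'.

Definition convex_iso (R : realType) (A B : convType R) (f : A -> B) : Prop :=
  convex_map f /\
  exists g : B -> A, [/\ convex_map g, cancel f g & cancel g f].

(* [share u v] is [u / (u + v)], which is [0] when [u = v = 0]. *)
Section Share.
Context {R : realType} (u v : {nonneg R}).

Let share_ge0 : 0 <= u%:num / (u%:num + v%:num).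
Proof. by rewrite divr_ge0. Qed.

Let share_le1 : u%:num / (u%:num + v%:num) <= 1.
Proof.
have [->|n0] := eqVneq (u%:num + v%:num) 0; first by rewrite invr0 mulr0.
by rewrite ler_pdivrMr ?mul1r ?lerDl// lt_neqAle eq_sym n0 addr_ge0.
Qed.

Definition share : {i01 R} := Itv01 share_ge0 share_le1.

End Share.

Section WeightedAverage.
Context {R : realType} (r s t : {i01 R}).

Let avg_ge0 : 0 <= r%:num * s%:num + r%:num.~ * t%:num.
Proof. by rewrite addr_ge0 ?mulr_ge0 ?onem_ge0. Qed.

Let avg_le1 : r%:num * s%:num + r%:num.~ * t%:num <= 1.
Proof.
rewrite -[X in _ <= X](add_onemK r%:num).
by apply: lerD; rewrite -[leRHS]mulr1 ler_wpM2l ?onem_ge0.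
Qed.

Definition wavg : {i01 R} := Itv01 avg_ge0 avg_le1.

End WeightedAverage.

Inductive star (R : realType) (A B : Type) : Type :=
| star_inl of A
| star_mix of {itv R & `]0, 1[} & A & B
| star_inr of B.
Arguments star_inl {R A B}.
Arguments star_inr {R A B}.

Section Star.
Context {R : realType}.

Definition star_weight A B (x : star R A B) : {i01 R} :=
  match x with
  | star_inl _ => 1%:i01
  | star_mix s _ _ => s%:num%:i01
  | star_inr _ => 0%:i01
  end.

(* [p . a + p^* . b] for [p] in [[0, 1]], components of weight [0] being
   dropped. *)
Definition star_comb A B (p : {i01 R}) (a : A) (b : B) : star R A B :=
  match pselect (0 < p%:num), pselect (p%:num < 1) with
  | left p0, left p1 =>
      star_mix (ItvReal (l := BRight 0%Z) (u := BLeft 1%Z) p0 p1) a b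
  | left _, right _ => star_inl a
  | right _, _ => star_inr b
  end.

(* As [p = r s + r^* t] satisfies [p^* = r s^* + r^* t^*], the weights [qA] and
   [qB] are [r s / p] and [r s^* / p^*]. *)
Definition star_conv (A B : convType R) (r : {i01 R}) (x y : star R A B) :
    star R A B :=
  let s := star_weight x in
  let t := star_weight y in
  let p := wavg r s t in
  let qA := share (r%:num * s%:num)%:nng ((1 - r%:num) * t%:num)%:nng in
  let qB := share (r%:num * (1 - s%:num))%:nng
                  ((1 - r%:num) * (1 - t%:num))%:nng in
  match x, y with
  | star_inl a, star_inl a' => star_inl (a <| r |> a')
  | star_inl a, star_mix _ a' b' => star_comb p (a <| qA |> a') b'
  | star_inl a, star_inr b' => star_comb p a b'
  | star_mix _ a b, star_inl a' => star_comb p (a <| qA |> a') b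
  | star_mix _ a b, star_mix _ a' b' =>
      star_comb p (a <| qA |> a') (b <| qB |> b')
  | star_mix _ a b, star_inr b' => star_comb p a (b <| qB |> b')
  | star_inr b, star_inl a' => star_comb p a' b
  | star_inr b, star_mix _ a' b' => star_comb p a' (b <| qB |> b')
  | star_inr b, star_inr b' => star_inr (b <| r |> b')
  end.

End Star.

(* The cone over [A]: a zero and the formal multiples [u . a] with [u > 0], the
   latter condition being imposed separately by [cone_pos].
   Formal convex combinations embed into pairs of cone elements, where the
   convex operation is [(r, x, y) |-> r . x + r^* . y]. *)
Section Cone.
Context {R : realType} {A : convType R}.

Definition cone := option ({nonneg R} * A).

Implicit Types (c d e : cone) (k l u v : {nonneg R}).

Definition cone_pos c := if c is Some (u, _) then 0 < u%:num else true.

Definition cone_scale k c : cone :=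
  if c is Some (u, a) then
    if k%:num == 0 then None else Some ((k%:num * u%:num)%:nng, a)
  else None.

Definition cone_add c d : cone :=
  match c, d with
  | None, _ => d
  | _, None => c
  | Some (u, a), Some (v, b) =>
      Some ((u%:num + v%:num)%:nng, a <| share u v |> b)
  end.

Definition cone_of k (a : A) : cone := if k%:num == 0 then None else Some (k, a).

Lemma cone_scale_pos k c : cone_pos c -> cone_pos (cone_scale k c).
Proof.
case: c => [[u a]|]//= u0; case: ifPn => //= k0.
by rewrite mulr_gt0// lt_neqAle eq_sym k0 /=.
Qed.

Lemma cone_addN c : cone_add c None = c.
Proof. by case: c => [[]|]. Qed.

Lemma cone_scale0 k c : k%:num = 0 -> cone_scale k c = None.
Proof. by case: c => [[u a]|]//= /eqP ->. Qed.

Lemma cone_scale1 k c : k%:num = 1 -> cone_scale k c = c.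
Proof.
move=> k1; case: c => [[u a]|]//=; case: eqP => k0.
  by move: (oner_neq0 R); rewrite -k1 k0 eqxx.
by congr (Some (_, _)); apply/val_inj; rewrite /= k1 mul1r.
Qed.

Lemma cone_scaleM k l m c : m%:num = k%:num * l%:num ->
  cone_scale k (cone_scale l c) = cone_scale m c.
Proof.
move=> mE; case: c => [[u a]|]//=.
have -> : (m%:num == 0) = (k%:num == 0) || (l%:num == 0) by rewrite mE mulf_eq0.
case: (eqVneq l%:num 0) => l0 /=; first by rewrite orbT.
rewrite orbF; case: eqVneq => // k0.
by congr (Some (_, _)); apply/val_inj; rewrite /= mE mulrA.
Qed.

Lemma cone_scaleD k c d : cone_pos c -> cone_pos d ->
  cone_scale k (cone_add c d) = cone_add (cone_scale k c) (cone_scale k d).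
Proof.
case: c d => [[u a]|] [[v b]|]//= u0 v0; rewrite ?cone_addN//.
case: eqVneq => //= k0; congr (Some (_, _ <| _ |> _)); apply/val_inj => /=.
  by rewrite mulrDr.
by rewrite -mulrDr -mulf_div divff// mul1r.
Qed.

Lemma cone_scaleDl k l m c : m%:num = k%:num + l%:num ->
  cone_scale m c = cone_add (cone_scale k c) (cone_scale l c).
Proof.
move=> mE; case: c => [[u a]|]//=.
have -> : (m%:num == 0) = (k%:num == 0) && (l%:num == 0).
  by rewrite mE paddr_eq0.
case: eqP => k0; case: eqP => l0 //=.
- by congr (Some (_, _)); apply/val_inj; rewrite /= mE k0 add0r.
- by congr (Some (_, _)); apply/val_inj; rewrite /= mE l0 addr0.
- rewrite convmm.
  by congr (Some (_, _)); apply/val_inj; rewrite /= mE mulrDl.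
Qed.

Lemma cone_addC c d : cone_pos c -> cone_pos d -> cone_add c d = cone_add d c.
Proof.
case: c d => [[u a]|] [[v b]|]//= u0 v0; rewrite [in LHS]convC.
congr (Some (_, _ <| _ |> _)); apply/val_inj => /=; first exact: addrC.
by field; rewrite !gt_eqF// addr_gt0.
Qed.

Lemma cone_addA c d e : cone_pos c -> cone_pos d -> cone_pos e ->
  cone_add c (cone_add d e) = cone_add (cone_add c d) e.
Proof.
case: c d e => [[u a]|] [[v b]|] [[w c]|]//= u0 v0 w0.
congr (Some (_, _)); first by apply/val_inj; rewrite /= addrA.
by apply: convA => /=; rewrite /onem; field;
  rewrite !gt_eqF// ?addr_gt0// ?addr_gt0.
Qed.

End Cone.
Arguments cone {R} A.

Section StarConvex.
Context {R : realType} {A B : convType R}.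
Implicit Types (x y z : star R A B) (r : {i01 R}).

Definition lcone x : cone A :=
  match x with
  | star_inl a => Some (1%:nng, a)
  | star_mix s a _ => Some (s%:num%:nng, a)
  | star_inr _ => None
  end.

Definition rcone x : cone B :=
  match x with
  | star_inl _ => None
  | star_mix s _ b => Some ((1 - s%:num)%:nng, b)
  | star_inr b => Some (1%:nng, b)
  end.

Lemma lcone_pos x : cone_pos (lcone x). Proof. by case: x => /=. Qed.

Lemma rcone_pos x : cone_pos (rcone x). Proof. by case: x => /=. Qed.

Lemma cones_inj x y : lcone x = lcone y -> rcone x = rcone y -> x = y.
Proof.
case: x y => [a|s a b|b] [a'|s' a' b'|b']//=.
- by move=> [->].
- move=> [ss ->] [_ ->]; congr star_mix; exact/val_inj.
- by move=> _ [->].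
Qed.

Lemma lcone_comb p a b : lcone (star_comb p a b) =
  cone_of p%:num%:nng a.
Proof.
rewrite /cone_of /=.
rewrite /star_comb; case: pselect => [p0|/negP p0]; last first.
  by rewrite ifT// eq_le leNgt p0/=.
rewrite gt_eqF//; case: pselect => [p1|/negP p1] /=;
  congr (Some (_, _)); apply/val_inj => //=.
by apply/eqP; rewrite eq_le [X in _ && X]le1 leNgt p1.
Qed.

Lemma rcone_comb p a b : rcone (star_comb p a b) =
  cone_of (1 - p%:num)%:nng b.
Proof.
rewrite /cone_of /=.
rewrite /star_comb; case: pselect => [p0|/negP p0]; last first.
  have pE : p%:num = 0 by apply/eqP; rewrite eq_le leNgt p0/=.
  rewrite ifF; last by rewrite pE subr0 oner_eq0.
  by congr (Some (_, _)); apply/val_inj; rewrite /= pE subr0.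
case: pselect => [p1|/negP p1]; last first.
  by rewrite ifT// subr_eq0 eq_le leNgt p1/=.
rewrite ifF /=; last by rewrite subr_eq0 gt_eqF.
by congr (Some (_, _)); apply/val_inj.
Qed.

End StarConvex.

Section Mixing.
Context {R : realType} {C : convType R}.
Implicit Types (a b : C) (k l u v p : {nonneg R}).

Lemma cone_mixE k l u v p a b q : 0 < u%:num -> 0 < v%:num ->
  p%:num = k%:num * u%:num + l%:num * v%:num ->
  q = share (k%:num * u%:num)%:nng (l%:num * v%:num)%:nng ->
  cone_add (cone_scale k (Some (u, a))) (cone_scale l (Some (v, b))) =
  cone_of p (a <| q |> b).
Proof.
rewrite /cone_of.
move=> u0 v0 pE -> /=.
have -> : (p%:num == 0) = (k%:num == 0) && (l%:num == 0).
  by rewrite pE paddr_eq0// !mulf_eq0 !(gt_eqF u0) !(gt_eqF v0) !orbF.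
case: eqP => k0; case: eqP => l0 //=; congr (Some (_, _)).
- by apply/val_inj; rewrite /= pE k0 mul0r add0r.
- rewrite [share _ _](_ : _ = 0%:i01) ?conv0//.
  by apply/val_inj; rewrite /= k0 !mul0r.
- by apply/val_inj; rewrite /= pE l0 mul0r addr0.
- rewrite [share _ _](_ : _ = 1%:i01) ?conv1//; apply/val_inj.
  rewrite /= l0 mul0r addr0 divff//.
  by apply: mulf_neq0; [exact/eqP | rewrite gt_eqF].
- by apply/val_inj; rewrite /= pE.
Qed.

Lemma cone_scaleE k u p a : 0 < u%:num -> p%:num = k%:num * u%:num ->
  cone_scale k (Some (u, a)) = cone_of p a.
Proof.
rewrite /cone_of.
move=> u0 pE /=.
have -> : (p%:num == 0) = (k%:num == 0) by rewrite pE mulf_eq0 (gt_eqF u0) orbF.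
by case: eqP => // _; congr (Some (_, _)); apply/val_inj.
Qed.

End Mixing.

Section StarConvType.
Context {R : realType} {A B : convType R}.
Implicit Types (x y z : star R A B) (r : {i01 R}).

Lemma lcone_conv r x y : lcone (star_conv r x y) =
  cone_add (cone_scale r%:num%:nng (lcone x))
           (cone_scale (1 - r%:num)%:nng (lcone y)).
Proof.
case: x y => [a|s a b|b] [a'|t a' b'|b']; rewrite /star_conv ?lcone_comb.
- rewrite [LHS](_ : _ = cone_of 1%:nng (a <| r |> a')); last first.
    by rewrite /cone_of /= oner_eq0.
  apply/esym/cone_mixE => //=; first by rewrite !mulr1 addrC subrK.
  by apply/val_inj; rewrite /= !mulr1 [r%:num + _]addrC subrK divr1.
- by apply/esym/cone_mixE => //=; apply/val_inj.
- rewrite cone_addN; apply/esym/cone_scaleE => //=.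
  by rewrite mulr0 addr0.
- by apply/esym/cone_mixE => //=; apply/val_inj.
- by apply/esym/cone_mixE => //=; apply/val_inj.
- rewrite cone_addN; apply/esym/cone_scaleE => //=.
  by rewrite mulr0 addr0.
- by apply/esym/cone_scaleE => //=; rewrite mulr0 add0r.
- by apply/esym/cone_scaleE => //=; rewrite mulr0 add0r.
- by [].
Qed.

Lemma rcone_conv r x y : rcone (star_conv r x y) =
  cone_add (cone_scale r%:num%:nng (rcone x))
           (cone_scale (1 - r%:num)%:nng (rcone y)).
Proof.
have wE (s t : R) : 1 - (r%:num * s + (1 - r%:num) * t) =
  r%:num * (1 - s) + (1 - r%:num) * (1 - t) by ring.
case: x y => [a|s a b|b] [a'|t a' b'|b']; rewrite /star_conv ?rcone_comb.
- by [].
- by apply/esym/cone_scaleE => //=; rewrite wE subrr mulr0 add0r.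
- by apply/esym/cone_scaleE => //=; rewrite wE subrr subr0 mulr0 add0r.
- rewrite cone_addN; apply/esym/cone_scaleE => //=.
  by rewrite wE subrr mulr0 addr0.
- by apply/esym/cone_mixE => //=; rewrite ?wE //; apply/val_inj.
- apply/esym/cone_mixE => //=.
  by rewrite wE subr0.
  by apply/val_inj; rewrite /= subr0.
- rewrite cone_addN; apply/esym/cone_scaleE => //=.
  by rewrite wE subrr subr0 mulr0 addr0.
- apply/esym/cone_mixE => //=.
  by rewrite wE subr0.
  by apply/val_inj; rewrite /= subr0.
- rewrite [LHS](_ : _ = cone_of 1%:nng (b <| r |> b')); last first.
    by rewrite /cone_of /= oner_eq0.
  apply/esym/cone_mixE => //=; first by rewrite !mulr1 addrC subrK.
  by apply/val_inj; rewrite /= !mulr1 [r%:num + _]addrC subrK divr1.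
Qed.

Let conv1 x y : star_conv 1%:i01 x y = x.
Proof.
apply: cones_inj; rewrite ?lcone_conv ?rcone_conv.
- by rewrite cone_scale1// cone_scale0 ?cone_addN //= subrr.
- by rewrite cone_scale1// cone_scale0 ?cone_addN //= subrr.
Qed.

Let convmm r x : star_conv r x x = x.
Proof.
apply: cones_inj; rewrite ?lcone_conv ?rcone_conv.
- by rewrite -(@cone_scaleDl _ _ _ _ 1%:nng) ?cone_scale1//= addrC subrK.
- by rewrite -(@cone_scaleDl _ _ _ _ 1%:nng) ?cone_scale1//= addrC subrK.
Qed.

Let cone_scale_eq (C : convType R) (k l : {nonneg R}) (c d : cone C) :
  k%:num = l%:num -> c = d -> cone_scale k c = cone_scale l d.
Proof. by move=> /val_inj -> ->. Qed.

Let convC r x y : star_conv r x y = star_conv (1 - r%:inum)%:i01 y x.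
Proof.
apply: cones_inj; rewrite ?lcone_conv ?rcone_conv.
- rewrite cone_addC; last 2 first.
  + exact/cone_scale_pos/lcone_pos.
  + exact/cone_scale_pos/lcone_pos.
  by congr cone_add; apply: cone_scale_eq => //=; rewrite opprB addrC subrK.
- rewrite cone_addC; last 2 first.
  + exact/cone_scale_pos/rcone_pos.
  + exact/cone_scale_pos/rcone_pos.
  by congr cone_add; apply: cone_scale_eq => //=; rewrite opprB addrC subrK.
Qed.

Let cone_convA (C : convType R) (p q r s : {i01 R}) (c d e : cone C) :
  p%:num = r%:num * s%:num -> s%:num.~ = p%:num.~ * q%:num.~ ->
  cone_pos c -> cone_pos d -> cone_pos e ->
  cone_add (cone_scale p%:num%:nng c)
    (cone_scale (1 - p%:num)%:nng
      (cone_add (cone_scale q%:num%:nng d) (cone_scale (1 - q%:num)%:nng e))) =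
  cone_add (cone_scale s%:num%:nng
      (cone_add (cone_scale r%:num%:nng c) (cone_scale (1 - r%:num)%:nng d)))
    (cone_scale (1 - s%:num)%:nng e).
Proof.
move=> prs spq c0 d0 e0.
rewrite !cone_scaleD ?cone_scale_pos// cone_addA ?cone_scale_pos//.
congr (cone_add (cone_add _ _) _).
- by apply/esym/cone_scaleM; rewrite /= prs mulrC.
- rewrite (@cone_scaleM _ _ _ _ ((1 - p%:num) * q%:num)%:nng)//.
  by apply/esym/cone_scaleM => /=; exact: ConvexQuasiAssoc.pq_sr prs spq.
- exact: cone_scaleM.
Qed.

Let convA : convex_quasi_associative (@star_conv R A B).
Proof.
move=> p q r s x y z prs spq.
by apply: cones_inj; rewrite ?lcone_conv ?rcone_conv;
  apply: cone_convA => //; exact: lcone_pos || exact: rcone_pos.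
Qed.

HB.instance Definition _ := gen_eqMixin (star R A B).
HB.instance Definition _ := gen_choiceMixin (star R A B).
HB.instance Definition _ :=
  isConvexSpace.Build R (star R A B) conv1 convmm convC convA.

End StarConvType.

(* The characterisation of the comparison map [D(A + B) -> DA * DB] out of the
   free convex space on [A + B]. *)
Definition is_comparison (R : realType) (A B : Type)
    (phi : dist R (A + B) -> star R (dist R A) (dist R B)) : Prop :=
  convex_map phi /\
  forall x : A + B, phi (point x) =
    match x with
    | inl a => star_inl (point a)
    | inr b => star_inr (point b)
    end.

(* Main.v *)
Require Import Defs.
From mathcomp Require Import all_boot all_order all_algebra.
From mathcomp Require Import interval_inference.
From mathcomp Require Import boolp classical_sets reals convex.
From mathcomp Require Import unstable functions cardinality fsbigop ring.

(* It is easier to work with the inverse of phi, which sends a formal convex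
   combination r . v + r^* . v' to the distribution that is r v on A and
   r^* v' on B. It is convex because the weight-and-distribution pairs in the
   cone of D A act as functions A -> R on which the cone operations become the
   pointwise ones; it is injective because the weight of a pair is its total
   mass, and the formula for phi exhibits a preimage of every distribution.
   Uniqueness holds because every distribution is an iterated convex
   combination of points. *)

Set Implicit Arguments.
Unset Strict Implicit.
Unset Printing Implicit Defensive.

Import Order.TTheory GRing.Theory Num.Theory.

Local Open Scope ring_scope.

(** * Masses on disjoint unions and of restrictions *)

Section MassLemmas.
Context {R : realType}.
Local Open Scope classical_set_scope.

(** The indicator of the range turns a sum over part of [C] into a mass on all of [C], so that
    [massD] can add two such sums. *)
Lemma mass_image A C (i : A -> C) (f : C -> R) : injective i ->
  mass (fun c => f c * `[< range i c >]%:R) = mass (f \o i).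
Proof.
move=> i_inj; rewrite [RHS]/mass.
rewrite -(fsbig_image _ (i : {classic A} -> {classic C}) f); last first.
  by move=> a a' _ _; apply: i_inj.
rewrite (@mass_widen _ _ _ (range i)).
  by apply: eq_fsbigr => c; rewrite inE => ic; case: asboolP; rewrite ?mulr1.
by move=> c; rewrite /supp /=; case: asboolP => // _; rewrite mulr0 eqxx.
Qed.

(** [f] is the sum of its products with the indicators of the two disjoint ranges. *)
Lemma mass_sum A B (f : A + B -> R) : finite_set (supp f) ->
  mass f = mass (f \o inl) + mass (f \o inr).
Proof.
move=> ff; rewrite -(mass_image _ (@inl_inj A B)) -(mass_image _ (@inr_inj A B)).
rewrite -massD.
- congr mass; apply/funext => -[a|b]; rewrite -mulrDr.
    case: asboolP => [_|[]]; last by exists a.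
    by case: asboolP => [[]//|_]; rewrite addr0 mulr1.
  case: asboolP => [[]//|_].
  by case: asboolP => [_|[]]; [rewrite add0r mulr1 | exists b].
- apply: sub_finite_set ff => c; rewrite /supp /= mulf_eq0.
  by rewrite negb_or => /andP[].
- apply: sub_finite_set ff => c; rewrite /supp /= mulf_eq0.
  by rewrite negb_or => /andP[].
Qed.

Lemma subdist_ge0 A (w : subdist R A) a : 0 <= w a.
Proof. by have /andP[] := subdist_itv w a. Qed.

Lemma mass_eq0 A (w : subdist R A) : mass w = 0 -> forall a, w a = 0.
Proof.
move=> w0 a; apply/eqP; rewrite eq_le subdist_ge0 andbT -w0.
by apply: le_mass => [|x]; [exact: subdist_fin | exact: subdist_ge0].
Qed.

Lemma mass_ge0 A (w : subdist R A) : 0 <= mass w.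
Proof. by apply: fsumr_ge0 => a _; exact: subdist_ge0. Qed.

Lemma mass_restr A B (w : dist R (A + B)) :
  mass (restr (@inl_inj A B) w) + mass (restr (@inr_inj A B) w) = 1.
Proof. by rewrite -(dist_mass w) mass_sum//; exact: subdist_fin. Qed.

Lemma normaliseE A (w : subdist R A) (w0 : 0 < mass w) a :
  mass w * normalise w0 a = w a.
Proof. by rewrite /= mulrC divfK ?gt_eqF. Qed.

Section MakeDist.
Context A (f : A -> R) (f_ge0 : forall a, 0 <= f a)
  (f_fin : finite_set (supp f)).

Section MakeSubdist.
Hypothesis f_le1 : mass f <= 1.

Let f_itv a : 0 <= f a <= 1.
Proof. by rewrite f_ge0 (le_trans (le_mass a f_fin f_ge0)). Qed.

Definition make_subdist : subdist R A := SubDist f_itv f_fin f_le1.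
End MakeSubdist.

Hypothesis f_mass : mass f = 1.

Let f_le1 : mass f <= 1. Proof. by rewrite f_mass. Qed.

Definition make_dist : dist R A := @Dist R A (make_subdist f_le1) f_mass.
End MakeDist.

End MassLemmas.

(** * Cone elements as functions [A -> R] *)

Section ConeCoef.
Context {R : realType} {A : Type}.
Local Open Scope convex_scope.
Implicit Types c d : cone (dist R A).

Definition cone_weight c : R := if c is Some (u, _) then u%:num else 0.

Definition cone_coef c (a : A) : R :=
  if c is Some (u, v) then u%:num * v a else 0.

Lemma cone_coef_ge0 c a : 0 <= cone_coef c a.
Proof. by case: c => [[u v]|]//=; rewrite mulr_ge0 ?subdist_ge0. Qed.

Lemma cone_coef_fin c : finite_set (supp (cone_coef c)).
Proof.
case: c => [[u v]|] /=.
  apply: sub_finite_set (subdist_fin v) => a; rewrite /supp /= mulf_eq0.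
  by rewrite negb_or => /andP[].
by apply: (sub_finite_set _ (@finite_set0 A)) => a; rewrite /supp /= eqxx.
Qed.

(** Distributions have mass 1, so the weight can be read off from the function. *)
Lemma mass_cone_coef c : mass (cone_coef c) = cone_weight c.
Proof.
case: c => [[u v]|] /=; first by rewrite massZ dist_mass mulr1.
by rewrite /mass fsbig1.
Qed.

Lemma cone_coefZ k c a : cone_coef (cone_scale k c) a = k%:num * cone_coef c a.
Proof.
case: c => [[u v]|] /=; last by rewrite mulr0.
by case: eqP => [->|_] /=; rewrite ?mul0r// mulrA.
Qed.

Lemma cone_coefD c d a :
  cone_coef (cone_add c d) a = cone_coef c a + cone_coef d a.
Proof.
case: c d => [[u v]|] [[u' v']|] /=; rewrite ?addr0 ?add0r//.
(* [share] divides by the total weight; if that is 0, both weights are 0 and so are both sides. *)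
have [uu0|uu0] := eqVneq (u%:num + u'%:num) 0.
  have /eqP := uu0; rewrite paddr_eq0// => /andP[/eqP -> /eqP ->].
  by rewrite !mul0r !addr0 mul0r.
by rewrite /onem; field.
Qed.

(** Equal functions have equal masses, hence equal weights, and a positive weight cancels.
    Positivity excludes [Some (0, v)], which has the same coefficients as [None]. *)
Lemma cone_coef_inj c d : cone_pos c -> cone_pos d ->
  cone_coef c =1 cone_coef d -> c = d.
Proof.
move=> c0 d0 cd; have := mass_cone_coef c.
rewrite (funext cd) mass_cone_coef.
case: c d c0 d0 cd => [[u v]|] [[u' v']|]//= u0 u'0 cd uu.
- have {}uu : u' = u by exact/val_inj.
  subst u'; congr (Some (_, _)); apply: dist_ext => a.
  by apply: (mulfI (lt0r_neq0 u0)); exact: cd.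
- by move: u0; rewrite -uu ltxx.
- by move: u'0; rewrite uu ltxx.
Qed.

End ConeCoef.

(** * The inverse map, from formal combinations to distributions on [A + B] *)

Section Flatten.
Context {R : realType} {A B : Type}.
Local Open Scope convex_scope.
Implicit Types x y : star R (dist R A) (dist R B).

Definition star_dist_fun x (c : A + B) : R :=
  match c with
  | inl a => cone_coef (lcone x) a
  | inr b => cone_coef (rcone x) b
  end.

Let star_dist_ge0 x c : 0 <= star_dist_fun x c.
Proof. by case: c => c; exact: cone_coef_ge0. Qed.

Let star_dist_fin x : finite_set (supp (star_dist_fun x)).
Proof.
apply: (@sub_finite_set _ _ (inl @` supp (cone_coef (lcone x)) `|`
                             inr @` supp (cone_coef (rcone x)))%classic).
  by move=> [a|b] h; [left; exists a | right; exists b].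
by rewrite finite_setU; split; apply: finite_image; exact: cone_coef_fin.
Qed.

Let star_dist_mass x : mass (star_dist_fun x) = 1.
Proof.
rewrite mass_sum//.
rewrite [X in X + _](mass_cone_coef (lcone x)).
rewrite [X in _ + X](mass_cone_coef (rcone x)).
(* The two weights are 1 and 0, [s] and [1 - s], or 0 and 1. *)
by case: x => [a|s a b|b] /=; rewrite ?addr0 ?add0r// addrC subrK.
Qed.

Definition star_dist x : dist R (A + B) :=
  make_dist (star_dist_ge0 x) (star_dist_fin x) (star_dist_mass x).

Lemma star_dist_convex : convex_map star_dist.
Proof.
move=> r x y; apply: dist_ext => -[a|b] /=.
  by rewrite lcone_conv cone_coefD !cone_coefZ.
by rewrite rcone_conv cone_coefD !cone_coefZ.
Qed.

Lemma star_dist_inj : injective star_dist.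
Proof.
move=> x y xy; have {}xy c : star_dist x c = star_dist y c by rewrite xy.
apply: cones_inj; apply: cone_coef_inj; rewrite ?lcone_pos ?rcone_pos//.
  by move=> a; exact: (xy (inl a)).
by move=> b; exact: (xy (inr b)).
Qed.

(** Values on the generators, from which those of [phi] on points follow by cancellation. *)
Lemma star_dist_point (c : A + B) : star_dist
    match c return star R (dist R A) (dist R B) with
    | inl a => star_inl (Defs.point a)
    | inr b => star_inr (Defs.point b)
    end = Defs.point c.
Proof.
apply: dist_ext; case: c => c [a|b] /=; rewrite ?mul1r.
- by congr (_ (nat_of_bool _)); apply: asbool_equiv_eq; split=> [->|[]].
- by case: asboolP.
- by case: asboolP.
- by congr (_ (nat_of_bool _)); apply: asbool_equiv_eq; split=> [->|[]].
Qed.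

Variable w : dist R (A + B).
Let w1 : subdist R A := restr (@inl_inj A B) w.
Let w2 : subdist R B := restr (@inr_inj A B) w.

(** All the mass lies on [A], so [w] vanishes on [B], as does the function of the absent right
    component. *)
Lemma star_dist_inl (h1 : mass w1 = 1) : star_dist (star_inl (Dist h1)) = w.
Proof.
apply: dist_ext => -[a|b] /=; first by rewrite mul1r.
have : mass w2 = 0 by have := mass_restr w; rewrite h1 -[RHS]addr0 => /addrI.
by move=> /mass_eq0 /(_ b).
Qed.

Lemma star_dist_inr (h2 : mass w2 = 1) : star_dist (star_inr (Dist h2)) = w.
Proof.
apply: dist_ext => -[a|b] /=; last by rewrite mul1r.
have : mass w1 = 0 by have := mass_restr w; rewrite h2 -[RHS]add0r => /addIr.
by move=> /mass_eq0 /(_ a).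
Qed.

(** The masses add up to 1, so if neither is 1 then neither is 0, and both restrictions can be
    normalised. *)
Lemma star_dist_mix : mass w1 <> 1 -> mass w2 <> 1 ->
  exists (r : {itv R & `]0, 1[}) (p1 : 0 < mass w1) (p2 : 0 < mass w2),
    [/\ r%:num = mass w1, 1 - r%:num = mass w2 &
        star_dist (star_mix r (normalise p1) (normalise p2)) = w].
Proof.
move=> n1 n2; have w12 : mass w1 + mass w2 = 1 := mass_restr w.
have p1 : 0 < mass w1.
  rewrite lt_neqAle mass_ge0 andbT eq_sym; apply/eqP => w10.
  by move: w12; rewrite w10 add0r.
have p2 : 0 < mass w2.
  rewrite lt_neqAle mass_ge0 andbT eq_sym; apply/eqP => w20.
  by move: w12; rewrite w20 addr0.
have lt1 : mass w1 < 1 by rewrite -w12 ltrDl.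
have w2E : 1 - mass w1 = mass w2 by rewrite -w12 addrC addKr.
exists (ItvReal (l := BRight 0%Z) (u := BLeft 1%Z) p1 lt1), p1, p2; split => //.
apply: dist_ext => -[a|b]; first exact: (normaliseE p1 a).
by rewrite -[RHS](normaliseE p2 b) -w2E.
Qed.

Lemma star_dist_surj : exists x, star_dist x = w.
Proof.
have [h1|n1] := pselect (mass w1 = 1).
  by exists (star_inl (Dist h1)); exact: star_dist_inl.
have [h2|n2] := pselect (mass w2 = 1).
  by exists (star_inr (Dist h2)); exact: star_dist_inr.
by have [r [p1 [p2 [_ _ <-]]]] := star_dist_mix n1 n2; eexists.
Qed.

End Flatten.

(** * Convex maps are determined by their values on points *)

Section PointsGenerate.
Context {R : realType} {C : Type}.
Local Open Scope convex_scope.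
Local Open Scope classical_set_scope.

Section Remove.
Variables (w : dist R C) (c : C).

Let f x := w x * `[< x <> c >]%:R.

Let f_ge0 x : 0 <= f x.
Proof. by rewrite mulr_ge0 ?subdist_ge0. Qed.

Let f_supp : supp f `<=` supp w.
Proof. by move=> x; rewrite /supp /= mulf_eq0 negb_or => /andP[]. Qed.

Let f_fin : finite_set (supp f).
Proof. exact: sub_finite_set f_supp (subdist_fin w). Qed.

Let f_le1 : mass f <= 1.
Proof.
rewrite -(dist_mass w); apply: mass_le => //; first exact: subdist_fin.
by move=> x; rewrite ler_piMr ?subdist_ge0//; case: asboolP.
Qed.

(** Left unnormalised, since its mass is 0 when [w] is the point distribution at [c]. *)
Definition dist_remove : subdist R C := make_subdist f_ge0 f_fin f_le1.

(** [w] is the sum of [dist_remove] and [w c] times the point at [c]. *)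
Lemma mass_dist_remove : mass dist_remove = 1 - w c.
Proof.
rewrite -(dist_mass w) -[w c]mulr1 -(mass_point c) -massZ.
apply/eqP; rewrite eq_sym subr_eq -massD.
- apply/eqP; congr mass; apply/funext => x /=; rewrite /f.
  case: (pselect (x = c)) => xc; last first.
    by rewrite (asboolT (P := x <> c))// asboolF// mulr1 mulr0 addr0.
  by rewrite xc asboolF ?asboolT// mulr0 mulr1 add0r.
- exact: f_fin.
- apply: (@sub_finite_set _ _ [set c]) => // x; rewrite /supp /=.
  by case: asboolP => // _; rewrite mulr0 eqxx.
Qed.

End Remove.

Lemma dist_split (w : dist R C) (c : C) (lt1 : 0 < mass (dist_remove w c)) :
  exists r : {i01 R}, w = (Defs.point c : dist R C) <| r |> normalise lt1.
Proof.
have wc1 : w c <= 1 by have /andP[] := subdist_itv w c.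
(* The point gets weight [w c]; the complementary weight cancels the normalising denominator. *)
exists (Itv01 (subdist_ge0 w c) wc1); apply: dist_ext => x.
rewrite [RHS]dist_convE /= /onem -mass_dist_remove [_ * (_ / _)]mulrC divfK ?gt_eqF//.
have [->|xc] := pselect (x = c).
  by rewrite asboolT// asboolF// mulr1 mulr0 addr0.
by rewrite asboolF// asboolT// mulr1 mulr0 add0r.
Qed.

(* Split off one point of the support at a time. *)
Lemma convex_map_ext (D : convType R) (f g : dist R C -> D) :
  convex_map f -> convex_map g ->
  (forall c, f (Defs.point c) = g (Defs.point c)) ->
  f =1 g.
Proof.
move=> fc gc fg w.
have /finite_seqP[s suppE] : finite_set (supp w : set {classic C}).
  exact: subdist_fin.
(* Only an inclusion in [s] is kept: it passes to the remainder with the tail of [s], even if [c]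
   lies outside the support or recurs in the tail. *)
have {suppE} : forall x, w x != 0 -> (x : {classic C}) \in s.
  by move=> x wx; have : (supp w : set {classic C}) x by []; rewrite suppE.
elim: s w => [|c s IH] w ws.
  have w0 x : w x = 0.
    by apply/eqP/negPn/negP => /ws.
  by have /eqP := dist_mass w; rewrite /mass fsbig1// eq_sym oner_eq0.
(* If nothing remains after removing [c], then [w] is the point at [c]; otherwise the remainder can
   be normalised. *)
have := mass_ge0 (dist_remove w c); rewrite le_eqVlt => /predU1P[rm0|rm_gt0].
  have wE : w = Defs.point c.
    apply: dist_ext => x /=; have [->|xc] := pselect (x = c).
      rewrite asboolT//; apply/esym/eqP; rewrite -subr_eq0 -mass_dist_remove.
      by rewrite -rm0.
    have := mass_eq0 (esym rm0) x; rewrite /= asboolT// mulr1 => ->.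
    by rewrite asboolF.
  by rewrite wE.
have [r ->] := dist_split rm_gt0; rewrite fc gc fg; congr (_ <| _ |> _).
apply: IH => x; rewrite /= !mulf_eq0 !negb_or => /andP[/andP[/ws + xc] _].
by rewrite inE => /predU1P[xE|//]; move: xc; rewrite xE asboolF// eqxx.
Qed.

End PointsGenerate.

(** * The comparison map and its formula *)

Theorem proposition8 (R : realType) (A B : Type) :
  exists phi : dist R (A + B) -> star R (dist R A) (dist R B),
    [/\ unique (@is_comparison R A B) phi,
        convex_iso phi &
        forall w : dist R (A + B),
          let w1 : subdist R A := restr (@inl_inj A B) w in
          let w2 : subdist R B := restr (@inr_inj A B) w in
          [/\ forall h1 : mass w1 = 1, phi w = star_inl (Dist h1),
              forall h2 : mass w2 = 1, phi w = star_inr (Dist h2) &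
              mass w1 <> 1 -> mass w2 <> 1 ->
              exists (r : {itv R & `]0, 1[}) (p1 : 0 < mass w1)
                     (p2 : 0 < mass w2),
                [/\ r%:num = mass w1, 1 - r%:num = mass w2 &
                    phi w = star_mix r (normalise p1) (normalise p2)]]].
Proof.
(* [phi] is a chosen right inverse of [star_dist]; injectivity makes it two-sided and carries
   convexity over to it. *)
have [phi star_distK] := choice (@star_dist_surj R A B).
have phiK : cancel star_dist phi by move=> x; apply: star_dist_inj.
have phi_convex : convex_map phi.
  by move=> r v w; apply: star_dist_inj; rewrite star_dist_convex !star_distK.
have phi_point x : phi (Defs.point x) =
    match x with
    | inl a => star_inl (Defs.point a)
    | inr b => star_inr (Defs.point b)
    end by rewrite -[in LHS]star_dist_point phiK.
exists phi; split.
- split=> [//|psi [psi_convex psi_point]]; apply/funext.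
  by apply: convex_map_ext => // x; rewrite phi_point psi_point.
- by split=> //; exists star_dist; split => //; exact: star_dist_convex.
(* In each case [w] is replaced by the image of its explicit preimage, which [phi] cancels. *)
- move=> w w1 w2; split=> [h1|h2|n1 n2].
  + by rewrite -[w in LHS](star_dist_inl h1) phiK.
  + by rewrite -[w in LHS](star_dist_inr h2) phiK.
  + have [r [p1 [p2 [r1 r2 wE]]]] := star_dist_mix n1 n2.
    by exists r, p1, p2; split; rewrite // -[w in LHS]wE phiK.
Qed.
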